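(* Let $r\ge 3$ and $1\le m<2^r$ be integers, let $a,b\in\mathbb{Z}$, and let $F(x)=x^{2^r}+ax^m+b\in\mathbb{Z}[x]$ be a monic polynomial irreducible over $\mathbb{Q}$. Let $K=\mathbb{Q}(\theta)$ be the number field generated by a root $\theta$ of $F(x)$. If $a$ and $b+1$ are both divisible by $32$, then $2$ is a prime common index divisor of $K$. In particular, $K$ is not monogenic.
   Context: For a number field $K$, $\mathbb{Z}_K$ denotes its ring of integers. $K$ is called monogenic if there exists $\eta\in\mathbb{Z}_K$ with $\mathbb{Z}_K=\mathbb{Z}[\eta]$. For $\eta\in\mathbb{Z}_K$ with $K=\mathbb{Q}(\eta)$, $\mathrm{ind}(\eta)$ denotes the index $(\mathbb{Z}_K:\mathbb{Z}[\eta])$. The index of $K$ is $i(K)=\gcd\{\mathrm{ind}(\eta)\mid \eta\in\mathbb{Z}_K,\ K=\mathbb{Q}(\eta)\}$. A prime $p$ dividing $i(K)$ is called a prime common index divisor of $K$. *)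

(* Defs.v *)
From HB Require Import structures.
From mathcomp Require Import all_boot all_order all_algebra all_field.
From mathcomp Require Import finmap.
From mathcomp Require Import boolp classical_sets functions cardinality.

Set Implicit Arguments.
Unset Strict Implicit.
Unset Printing Implicit Defensive.

Import GRing.Theory.

Local Open Scope classical_set_scope.
Local Open Scope ring_scope.

Definition ring_of_integers (K : fieldExtType rat) : set K :=
  [set x | integralOver (intr : int -> K) x].
Arguments ring_of_integers : clear implicits.

Definition Zadjoin (K : fieldExtType rat) (eta : K) : set K :=
  [set (map_poly intr p).[eta] | p in [set: {poly int}]].

Definition monogenic (K : fieldExtType rat) : Prop :=
  exists2 eta : K, ring_of_integers K eta & ring_of_integers K = Zadjoin eta.

Definition cosets (V : zmodType) (A B : set V) : set (set V) :=
  [set [set x + b | b in B] | x in A].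

(** The index (A : B) of additive groups B <= A. As [fset_set] sends infinite
    sets to the empty one, an infinite index is 0. *)
Definition subgroup_index (V : zmodType) (A B : set V) : nat :=
  #|` fset_set (cosets A B)|%fset.

Definition ind (K : fieldExtType rat) (eta : K) : nat :=
  subgroup_index (ring_of_integers K) (Zadjoin eta).

Definition is_gcd (S : set nat) (g : nat) : Prop :=
  (forall n, S n -> (g %| n)%N) /\
  (forall d, (forall n, S n -> (d %| n)%N) -> (d %| g)%N).

Definition gcd_set (S : set nat) : nat := get (is_gcd S).

Lemma is_gcd_uniq (S : set nat) (g h : nat) : is_gcd S g -> is_gcd S h -> g = h.
Proof.
move=> [gS gmax] [hS hmax]; apply/eqP.
by rewrite eqn_dvd hmax // gmax.
Qed.

Lemma gcd_setP (S : set nat) : is_gcd S (gcd_set S).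
Proof.
apply: getPex.
have [[n [Sn n_gt0]]|S0] := pselect (exists n, S n /\ (0 < n)%N); last first.
  exists 0%N; split=> [k Sk|d _]; last exact: dvdn0.
  by case: k Sk => // k Sk; case: S0; exists k.+1.
pose P g := `[< forall k, S k -> (g %| k)%N >].
have P1 : exists g, P g by exists 1%N; apply/asboolP => k _; exact: dvd1n.
have Pn g : P g -> (g <= n)%N by move=> /asboolP /(_ _ Sn); exact: dvdn_leq.
case: (ex_maxnP P1 Pn) => g /asboolP gS gmax; exists g; split=> // d dS.
have gd_gt0 : (0 < lcmn g d)%N.
  by rewrite lcmn_gt0 (dvdn_gt0 n_gt0 (gS _ Sn)) (dvdn_gt0 n_gt0 (dS _ Sn)).
have /gmax gd_le : P (lcmn g d).
  by apply/asboolP => k Sk; rewrite dvdn_lcm gS // dS.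
suff <- : lcmn g d = g by exact: dvdn_lcmr.
by apply/eqP; rewrite eqn_leq gd_le dvdn_leq // dvdn_lcml.
Qed.

(** [<<1; eta>>] is the subfield Q(eta). *)
Definition field_index (K : fieldExtType rat) : nat :=
  gcd_set [set ind eta | eta in
    [set eta : K | ring_of_integers K eta /\ <<1; eta>>%VS = {:K}%VS]].

Definition prime_common_index_divisor (K : fieldExtType rat) (p : nat) : Prop :=
  prime p /\ (p %| field_index K)%N.

(* Main.v *)
(** Put y = theta - 1, q = 2^(r-3) and t = (1 + Y)^q - 1, so that
    F(1 + Y) = (1 + t)^8 - 1 + 32 C(Y). The Newton polygon of F(1 + Y) at 2 has
    sides of slopes -1/(4q), -1/(2q) and -1/q; for e one of 4q, 2q, q, in terms
    of s = y^e / 2 the side reads s^2 + s = 0 modulo (2, y). Hence y |-> 0,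
    s |-> 1 defines a homomorphism from Z[y, s] to F_2 whose kernel is locally
    generated by y. The localization is thus a discrete valuation ring, contains
    Z_K, and gives a homomorphism Z_K -> F_2. The three homomorphisms obtained in
    this way are distinct, but two of them agree at any given eta because F_2
    has only two elements; they then agree on Z[eta], which therefore cannot
    have odd index in Z_K. *)
From HB Require Import structures.
Require Import Defs.
From mathcomp Require Import all_boot all_order all_algebra all_field.
From mathcomp Require Import finmap.
From mathcomp Require Import boolp classical_sets functions cardinality.
From mathcomp Require Import ring.

Set Implicit Arguments.
Unset Strict Implicit.
Unset Printing Implicit Defensive.

Import GRing.Theory Num.Theory.

Local Open Scope ring_scope.

(** * Reduction modulo 2 and evaluation of polynomials in Y and S *)

Definition mod2 : {poly {poly int}} -> {poly {poly 'F_2}} :=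
  map_poly (map_poly intr).
HB.instance Definition _ := GRing.RMorphism.on mod2.

Lemma intrF2_eq0 (n : int) : (n%:~R == 0 :> 'F_2) = (2 %| n)%Z.
Proof.
have pchar2 : 2 \in [pchar 'F_2] by exact: pchar_Fp.
case: n => n; first by rewrite -pmulrn -(dvdn_pcharf pchar2).
by rewrite NegzE mulrNz oppr_eq0 -pmulrn -(dvdn_pcharf pchar2).
Qed.

Lemma intrF2_lift (c : 'F_2) : (c : nat)%:~R = c.
Proof. by rewrite -pmulrn natr_Zp. Qed.

Lemma mod2_surj (Q : {poly {poly 'F_2}}) : exists P, mod2 P = Q.
Proof.
exists (map_poly (map_poly (fun c : 'F_2 => (c : nat)%:Z)) Q).
(* The lift F_2 -> Z is not additive; [coef_map_id0] only asks that it fix 0. *)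
apply/polyP => i; rewrite coef_map_id0 ?rmorph0 // coef_map_id0 ?map_polyC0 //; last first.
  by rewrite /map_poly poly_def size_poly0 big_ord0.
by apply/polyP => j; rewrite coef_map_id0 // coef_map_id0 // intrF2_lift.
Qed.

Lemma mod2_eq0 (P : {poly {poly int}}) : mod2 P = 0 -> exists Q, P = 2 * Q.
Proof.
move=> P0; exists (map_poly (map_poly (fun n => n %/ 2)%Z) P).
apply/polyP => i; rewrite mulr_natl coefMn coef_map_id0; last first.
  by rewrite /map_poly poly_def size_poly0 big_ord0.
apply/polyP => j; rewrite coefMn coef_map_id0 //.
move: P0 => /polyP /(_ i) /polyP /(_ j).
rewrite coef_map_id0 ?rmorph0 // coef_map_id0 // !coef0.
move/eqP; rewrite intrF2_eq0 => /divzK E.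
by rewrite -[LHS]E -[RHS]mulr_natr.
Qed.

Lemma mod2_double P : mod2 (2 * P) = 0.
Proof.
rewrite rmorphM rmorph_nat; suff -> : 2%:R = 0 :> {poly {poly 'F_2}} by rewrite mul0r.
by rewrite -!polyC_natr (pcharf0 (pchar_Fp (isT : prime 2))) !polyC0.
Qed.

(** Evaluation at 0 shows that X divides Q, and X is cancelled n times. With R = F_2[S], the
    hypothesis on P says that Y does not divide it. *)
Lemma dvdXn_mul (R : idomainType) (P Q : {poly R}) n :
  P.[0] != 0 -> (exists M, P * Q = 'X^n * M) -> exists M, Q = 'X^n * M.
Proof.
move=> P0; elim: n Q => [|n IHn] Q [M EM]; first by exists Q; rewrite mul1r.
have /factor_theorem [N EN] : root Q 0.
  have /eqP := congr1 (horner^~ 0) EM.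
  by rewrite !hornerM hornerXn expr0n mul0r mulf_eq0 (negPf P0).
rewrite subr0 in EN.
have [|M' EM'] := IHn N; last by exists M'; rewrite EN EM' exprSr; ring.
exists M; have X0 : 'X != 0 :> {poly R} by rewrite polyX_eq0.
apply: (mulIf X0).
by rewrite -mulrA -EN EM exprSr; ring.
Qed.

(* The variable of the outer polynomial is Y, evaluated at [y]; the inner one is
   S, evaluated at [s]. *)
Definition ev2 (R : comNzRingType) (y s : R) : {poly {poly int}} -> R :=
  horner_eval s \o horner_eval y%:P \o map_poly (map_poly intr).
HB.instance Definition _ (R : comNzRingType) (y s : R) :=
  GRing.RMorphism.on (ev2 y s).

Lemma ev2_X (R : comNzRingType) (y s : R) : ev2 y s 'X = y.
Proof. by rewrite /ev2 /= map_polyX /horner_eval hornerX hornerC. Qed.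

Lemma ev2_S (R : comNzRingType) (y s : R) : ev2 y s 'X%:P = s.
Proof. by rewrite /ev2 /= map_polyC /= map_polyX /horner_eval hornerC hornerX. Qed.

Lemma ev2_poly (R : comNzRingType) (y s : R) (p : {poly int}) :
  ev2 y s p^:P = (map_poly intr p).[y].
Proof.
elim/poly_ind: p => [|p n IHp]; first by rewrite !rmorph0 horner0.
rewrite !rmorphD !rmorphM /= IHp !map_polyX !map_polyC /= ev2_X hornerMXaddC.
congr (_ + _).
by rewrite /ev2 /= map_polyC /= map_polyC /horner_eval !hornerC.
Qed.

(* Generates the relation S = Y^e / 2. *)
Definition side (e : nat) : {poly {poly int}} := 2 * 'X%:P - 'X^e.

(** * Relations between y and y^e / 2, and their image at (0, 1) in F_2 *)

(** Modulo [side e] one has 2 S = Y^e, so enough factors 2 turn every power of S into a power of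
    Y. *)
Lemma side_clear_denom e (b : {poly {poly int}}) :
  exists d p D, 2 ^+ d * b = p^:P + side e * D.
Proof.
have addP b1 b2 : (exists d p D, 2 ^+ d * b1 = p^:P + side e * D) ->
    (exists d p D, 2 ^+ d * b2 = p^:P + side e * D) ->
    exists d p D, 2 ^+ d * (b1 + b2) = p^:P + side e * D.
  move=> [d1 [p1 [D1 E1]]] [d2 [p2 [D2 E2]]].
  exists (d1 + d2), (2 ^+ d2 * p1 + 2 ^+ d1 * p2), (2 ^+ d2 * D1 + 2 ^+ d1 * D2).
  rewrite rmorphD !rmorphM !rmorphXn /= !rmorph_nat.
  have -> : 2 ^+ (d1 + d2) * (b1 + b2) =
    2 ^+ d2 * (2 ^+ d1 * b1) + 2 ^+ d1 * (2 ^+ d2 * b2) by rewrite exprD; ring.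
  by rewrite E1 E2; ring.
elim/poly_ind: b => [|b c [d [p [D Eb]]]]; first
  by exists 0, 0, 0; rewrite rmorph0; ring.
apply: (addP).
  by exists d, (p * 'X), (D * 'X); rewrite rmorphM /= map_polyX (mulrA _ b) Eb; ring.
elim/poly_ind: c => [|c n [d' [p' [D' Ec]]]]; first
  by exists 0, 0, 0; rewrite !rmorph0; ring.
rewrite polyCD; apply: (addP); last first.
  by exists 0, n%:P, 0; rewrite map_polyC /=; ring.
exists d'.+1, (p' * 'X^e), (D' * 'X^e + 2 ^+ d' * c%:P).
rewrite polyCM exprS [(p' * _)^:P]rmorphM rmorphXn /= map_polyX.
have -> : 2 * 2 ^+ d' * (c%:P * 'X%:P) = (2 ^+ d' * c%:P) * (side e + 'X^e).
  by rewrite /side; ring.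
by rewrite mulrDr Ec; ring.
Qed.

Lemma mod2_X : mod2 'X = 'X.
Proof. exact: map_polyX. Qed.

Lemma mod2_side e : mod2 (side e) = - 'X^e.
Proof. by rewrite /side rmorphB /= mod2_double sub0r rmorphXn /= mod2_X. Qed.

(* Modulo 2 the relation reads [G V = Y^e D], and Y does not divide G mod 2. *)
Lemma side_saturated_step e (G b V D : {poly {poly int}}) :
    (mod2 G).[0] != 0 -> 2 * b = G * V + side e * D ->
  exists V' D', b = G * V' + side e * D'.
Proof.
move=> G0 E; have := congr1 mod2 E.
rewrite mod2_double rmorphD !rmorphM /= mod2_side mulNr => /esym/eqP.
rewrite subr_eq0 => /eqP E2.
have [M EM] : exists M, mod2 V = 'X^e * M.
  by apply: (dvdXn_mul G0); exists (mod2 D).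
have ED : mod2 D = mod2 G * M.
  have Xe0 : 'X^e != 0 :> {poly {poly 'F_2}} by rewrite expf_neq0 // polyX_eq0.
  by apply: (mulfI Xe0); rewrite -E2 EM; ring.
have [N EN] := mod2_surj M.
have [V' EV'] : exists V', V - 'X^e * N = 2 * V'.
  by apply: mod2_eq0; rewrite rmorphB rmorphM rmorphXn /= EM EN mod2_X subrr.
have [D' ED'] : exists D', D - G * N = 2 * D'.
  by apply: mod2_eq0; rewrite rmorphB rmorphM /= ED EN subrr.
(* The terms in N add up to (Y^e + [side e]) G N = 2 S G N. *)
exists (V' + 'X%:P * N), D'.
have two0 : 2 != 0 :> {poly {poly int}} by rewrite -!polyC_natr !polyC_eq0.
apply: (mulfI two0); rewrite E.
have -> : V = 2 * V' + 'X^e * N by rewrite -EV'; ring.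
have -> : D = 2 * D' + G * N by rewrite -ED'; ring.
by rewrite /side; ring.
Qed.

(** By iteration, the quotient of Z[Y, S] by [G] and [side e] has no 2-torsion. *)
Lemma side_saturated e (G b V D : {poly {poly int}}) d :
    (mod2 G).[0] != 0 -> 2 ^+ d * b = G * V + side e * D ->
  exists V' D', b = G * V' + side e * D'.
Proof.
move=> G0; elim: d b V D => [|d IHd] b V D E; first by exists V, D; rewrite -E mul1r.
rewrite exprS -mulrA in E; have [V' [D' E']] := side_saturated_step G0 E.
exact: IHd E'.
Qed.

(** Modulo (2, Y) only S (S + 1) survives, which is nonzero: this is what saturation asks of its
    generator. *)
Lemma mod2_lead_neq0 (A B : {poly {poly int}}) :
  (mod2 ('X%:P ^+ 2 + 'X%:P + 2 * A + 'X * B)).[0] != 0.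
Proof.
rewrite !rmorphD /= mod2_double rmorphXn rmorphM /= addr0 !hornerE.
rewrite mod2_X hornerX mul0r addr0.
rewrite /mod2 map_polyC /= map_polyX hornerC.
have -> : 'X ^+ 2 + 'X = ('X + 1) * 'X :> {poly 'F_2} by ring.
by rewrite mulf_neq0 ?polyX_eq0 // -size_poly_eq0 -(opprK 1) -polyCN size_XsubC.
Qed.

(** Clearing denominators turns a relation b = 0 into p(y) = 0 with p in Z[Y], so G divides p.
    Modulo [side e], G is 2^k times [G']; saturation then puts b itself in the ideal of [G'] and
    [side e], and both of these vanish at (0, 1) in F_2. *)
Lemma ev2_wd (K : fieldExtType rat) (y : K) (e k : nat) (G : {poly int})
    (A B D : {poly {poly int}}) (b : {poly {poly int}}) :
    (0 < e)%N ->
    (forall p : {poly int}, (map_poly intr p).[y] = 0 -> exists Q, p = G * Q) ->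
    G^:P = 2 ^+ k * ('X%:P ^+ 2 + 'X%:P + 2 * A + 'X * B) + side e * D ->
  ev2 y (y ^+ e / 2) b = 0 -> ev2 0 1 b = 0 :> 'F_2.
Proof.
move=> e0 hG EG b0; set G' := (X in _ * X + _) in EG.
have two0 : 2 != 0 :> K by rewrite -(rmorph_nat (in_alg K)) fmorph_eq0.
have side0 : ev2 y (y ^+ e / 2) (side e) = 0.
  rewrite /side rmorphB rmorphM rmorphXn rmorph_nat /= ev2_X ev2_S.
  by rewrite mulrCA mulfV // mulr1 subrr.
have [d [p [E Eb]]] := side_clear_denom e b.
have [Q EQ] : exists Q, p = G * Q.
  apply: hG; have := congr1 (ev2 y (y ^+ e / 2)) Eb.
  by rewrite rmorphM /= b0 mulr0 rmorphD rmorphM /= side0 mul0r addr0 ev2_poly => <-.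
have EbG : 2 ^+ d * b = G' * (2 ^+ k * Q^:P) + side e * (D * Q^:P + E).
  by rewrite Eb EQ rmorphM /= EG; ring.
have [V [E' ->]] := side_saturated (mod2_lead_neq0 A B) EbG.
have F2 : 2%:R = 0 :> 'F_2 by exact: pcharf0 (pchar_Fp _).
rewrite rmorphD !rmorphM /= /G' /side rmorphB !rmorphD !rmorphM !rmorphXn !rmorph_nat /=.
rewrite !ev2_X !ev2_S expr0n eqn0Ngt e0 F2.
by rewrite mulr1 -[1 + 1]/2%:R F2 /= !(mul0r, addr0, subr0).
Qed.

(** * The local ring of a side, its residue map, and the extension to Z_K *)

(** The second clause makes (y, s) |-> (0, 1) well defined on Z[y, s], s = y^e / 2; the third, s^2 +
    s in (2, y), makes the maximal ideal principal. *)
Definition regular_side (K : fieldExtType rat) (y : K) (e : nat) : Prop :=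
  [/\ (0 < e)%N,
      forall b, ev2 y (y ^+ e / 2) b = 0 -> ev2 0 1 b = 0 :> 'F_2
    & exists A B, ev2 y (y ^+ e / 2) ('X%:P ^+ 2 + 'X%:P + 2 * A + 'X * B) = 0].

(* [x] lies in the localization of Z[y, y^e / 2] at the kernel of (y, s) |-> (0, 1)
   and has residue [v] there. *)
Definition residue (K : fieldExtType rat) (y : K) (e : nat) (x : K) (v : 'F_2) : Prop :=
  exists b c, [/\ ev2 0 1 c = 1 :> 'F_2,
    x * ev2 y (y ^+ e / 2) c = ev2 y (y ^+ e / 2) b & v = ev2 0 1 b].

Lemma F2_neq0 (v : 'F_2) : v != 0 -> v = 1.
Proof. by case: v => [[|[|]]] // i _; apply/val_inj. Qed.

Lemma ratext_natr_eq0 (K : fieldExtType rat) n : (n%:R == 0 :> K) = (n == 0)%N.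
Proof. by rewrite -(rmorph_nat (in_alg K)) fmorph_eq0 pnatr_eq0. Qed.

Lemma residue_ev (K : fieldExtType rat) (y : K) e b :
  residue y e (ev2 y (y ^+ e / 2) b) (ev2 0 1 b).
Proof. by exists b, 1; rewrite !rmorph1 mulr1. Qed.

Lemma residueD (K : fieldExtType rat) (y x x' : K) e v v' :
  residue y e x v -> residue y e x' v' -> residue y e (x + x') (v + v').
Proof.
move=> [b [c [c1 E ->]]] [b' [c' [c1' E' ->]]].
exists (b * c' + b' * c), (c * c'); rewrite !rmorphD !rmorphM /= c1 c1' !mulr1.
by split=> //; rewrite -E -E'; ring.
Qed.

Lemma residueM (K : fieldExtType rat) (y x x' : K) e v v' :
  residue y e x v -> residue y e x' v' -> residue y e (x * x') (v * v').
Proof.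
move=> [b [c [c1 E ->]]] [b' [c' [c1' E' ->]]].
exists (b * b'), (c * c'); rewrite !rmorphM /= c1 c1' mulr1.
by split=> //; rewrite -E -E'; ring.
Qed.

Lemma residue_int (K : fieldExtType rat) (y : K) e (n : int) :
  residue y e n%:~R n%:~R.
Proof. by exists n%:~R, 1; rewrite !rmorph1 mulr1 !rmorph_int. Qed.

Lemma residue_nat (K : fieldExtType rat) (y : K) e n : residue y e n%:R n%:R.
Proof. by exists n%:R, 1; rewrite !rmorph1 mulr1 !rmorph_nat. Qed.

Lemma residueN (K : fieldExtType rat) (y x : K) e v :
  residue y e x v -> residue y e (- x) (- v).
Proof.
by move=> [b [c [c1 E ->]]]; exists (- b), c; rewrite !rmorphN mulNr E.
Qed.

Lemma residueX (K : fieldExtType rat) (y x : K) e v n :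
  residue y e x v -> residue y e (x ^+ n) (v ^+ n).
Proof.
move=> xv; elim: n => [|n IHn]; first exact: residue_nat 1%N.
by rewrite !exprS; exact: residueM.
Qed.

Lemma residue_horner (K : fieldExtType rat) (y x : K) e v (p : {poly int}) :
  residue y e x v -> residue y e (map_poly intr p).[x] (map_poly intr p).[v].
Proof.
move=> xv; elim/poly_ind: p => [|p n IHp].
  by rewrite !rmorph0 !horner0; exact: residue_nat 0%N.
rewrite !rmorphD !rmorphM /= !map_polyX !map_polyC /= !hornerMXaddC.
by apply: residueD (residue_int _ _ _); exact: residueM.
Qed.

(** Equal fractions b / c and b' / c' give the relation b c' - b' c = 0, which persists at (0,
    1). *)
Lemma residue_uniq (K : fieldExtType rat) (y x : K) e v v' :
  regular_side y e -> residue y e x v -> residue y e x v' -> v = v'.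
Proof.
move=> [_ wd _] [b [c [c1 E ->]]] [b' [c' [c1' E' ->]]].
have /wd : ev2 y (y ^+ e / 2) (b * c' - b' * c) = 0.
  by rewrite rmorphB !rmorphM /= -E -E'; ring.
rewrite rmorphB !rmorphM /= c1 c1' !mulr1 => /eqP.
by rewrite subr_eq0 => /eqP.
Qed.

Lemma regular_side_neq0 (K : fieldExtType rat) (y : K) e b :
  regular_side y e -> ev2 0 1 b = 1 :> 'F_2 -> ev2 y (y ^+ e / 2) b != 0.
Proof.
move=> [_ wd _] b1; apply/eqP => /wd /eqP.
by rewrite b1 oner_eq0.
Qed.

Lemma residueV (K : fieldExtType rat) (y x : K) e :
  regular_side y e -> residue y e x 1 -> residue y e x^-1 1.
Proof.
move=> reg [b [c [c1 E b1]]]; exists c, b; split=> //.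
have b0 := regular_side_neq0 reg (esym b1).
have x0 : x != 0 by apply: contraNneq b0 => x0; rewrite -E x0 mul0r.
by rewrite -E mulKf.
Qed.

(** If y were 0, then so would be s, whose residue is 1. *)
Lemma regular_side_param_neq0 (K : fieldExtType rat) (y : K) e :
  regular_side y e -> y != 0.
Proof.
move=> reg; have [e0 _ _] := reg.
have := regular_side_neq0 (b := 'X%:P) reg; rewrite !ev2_S => /(_ erefl).
by apply: contra_neq => ->; rewrite expr0n eqn0Ngt e0 mul0r.
Qed.

Lemma residue_S (K : fieldExtType rat) (y : K) e : residue y e (y ^+ e / 2) 1.
Proof. by have := residue_ev y e 'X%:P; rewrite !ev2_S. Qed.

(* 2 = y^e / s with s a unit, and s + 1 = - (2 A + y B) / s: hence y generates
   the maximal ideal (2, y, s - 1). *)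
Lemma residue_div_param (K : fieldExtType rat) (y x : K) e :
  regular_side y e -> residue y e x 0 -> exists v, residue y e (x / y) v.
Proof.
move=> reg [b [c [c1 E b0]]].
have [e0 _ [A [B AB0]]] := reg.
pose s := y ^+ e / 2; have y0 := regular_side_param_neq0 reg.
have two0 : 2 != 0 :> K by rewrite ratext_natr_eq0.
have sV : residue y e s^-1 1 by apply: residueV reg (residue_S _ _).
have s0 : s != 0 by rewrite mulf_neq0 ?invr_eq0 ?expf_neq0.
have yV : residue y e y 0 by have := residue_ev y e 'X; rewrite !ev2_X.
have two_y : exists v, residue y e (2 / y) v.
  exists (0 ^+ e.-1 * 1); have -> : 2 / y = y ^+ e.-1 * s^-1.
    rewrite /s invf_div; apply: (mulIf y0); rewrite divfK // mulrAC -exprSr prednK //.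
    by rewrite mulrCA mulfV ?mulr1 // expf_neq0.
  by apply: residueM => //; exact: residueX.
have [t twot] := two_y.
(* Here (s - 1) / y = (s + 1) / y - 2 / y, and the side equation yields the first term. *)
have S_y : exists v, residue y e ((s - 1) / y) v.
  exists (- (t * ev2 0 1 A + ev2 0 1 B) * 1 - t).
  have -> : (s - 1) / y = - (2 / y * ev2 y s A + ev2 y s B) * s^-1 - 2 / y.
    move: AB0; rewrite !rmorphD !rmorphM rmorph_nat /= ev2_X ev2_S -/s => AB0.
    have -> : ev2 y s B = - (s * s + s + 2 * ev2 y s A) / y.
      apply: (mulIf y0); rewrite divfK // mulrC; apply/eqP.
      by rewrite -addr_eq0 addrC AB0.
    by field; rewrite y0 s0.
  apply: residueD; last exact: residueN.
  apply: residueM => //; apply: residueN; apply: residueD; last exact: residue_ev.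
  by apply: residueM => //; exact: residue_ev.
have [t' St] := S_y.
(* Division by Y and then by S - 1 leaves a constant n, even because b vanishes at (0, 1) in F_2. *)
have [b1 [n [b2 Eb]]] : exists b1 (n : int) b2,
    b = b1 * 'X + b2 * ('X%:P - 1) + n%:~R.
  elim/poly_ind: (b) => [|b1 p _]; first by exists 0, 0, 0; ring.
  have /factor_theorem [q Eq] : root (p - p.[1]%:P) 1 by rewrite rootE !hornerE subrr.
  exists b1, p.[1], q%:P; rewrite -[p in LHS](subrK p.[1]%:P) Eq.
  rewrite polyCD polyCM polyCB !polyC1 addrA; congr (_ + _).
  by rewrite -[in LHS](intz p.[1]) !rmorph_int.
have /divzK En : (2 %| n)%Z.
  rewrite -intrF2_eq0; move: b0; rewrite Eb !rmorphD !rmorphM rmorphB rmorph_int rmorph1 /=.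
  by rewrite ev2_X ev2_S subrr !mulr0 !add0r => <-.
exists (ev2 0 1 b1 + ev2 0 1 b2 * t' + (n %/ 2)%Z%:~R * t).
have xc : residue y e (ev2 y s b / y) (ev2 0 1 b1 + ev2 0 1 b2 * t' + (n %/ 2)%Z%:~R * t).
  have -> : ev2 y s b / y = ev2 y s b1 + ev2 y s b2 * ((s - 1) / y) + (n %/ 2)%Z%:~R * (2 / y).
    rewrite Eb !rmorphD !rmorphM rmorphB rmorph_int rmorph1 /= ev2_X ev2_S -[in LHS]En.
    by rewrite intrM; field.
  apply: residueD.
    by apply: residueD; [|apply: residueM => //]; exact: residue_ev.
  by apply: residueM => //; exact: residue_int.
have c0 := regular_side_neq0 reg c1.
have -> : x / y = ev2 y s b / y * (ev2 y s c)^-1 by rewrite -E mulrAC mulfK.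
rewrite -[X in residue _ _ _ X]mulr1; apply: residueM => //.
by apply: residueV => //; rewrite -c1; exact: residue_ev.
Qed.

(** As long as x y^k has residue 0, it can be divided by y. If residue 1 occurs with k > 0, then 1 /
    x is a unit times y^k. *)
Lemma residue_dichotomy (K : fieldExtType rat) (y x : K) e k v :
    regular_side y e -> x != 0 -> residue y e (x * y ^+ k) v ->
  (exists w, residue y e x w) \/ residue y e x^-1 0.
Proof.
move=> reg x0; have y0 := regular_side_param_neq0 reg.
elim: k v => [|k IHk] v xv; first by left; exists v; rewrite expr0 mulr1 in xv.
have [v0|/F2_neq0 v1] := eqVneq v 0.
  rewrite v0 in xv; have [w] := residue_div_param reg xv.
  by rewrite exprSr mulrA mulfK //; exact: IHk.
right; rewrite v1 in xv.
have -> : x^-1 = (x * y ^+ k.+1)^-1 * y ^+ k.+1.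
  by rewrite invfM divfK // expf_neq0.
have y_0 : residue y e y 0 by have := residue_ev y e 'X; rewrite !ev2_X.
have -> : 0 = 1 * 0 ^+ k.+1 :> 'F_2 by rewrite expr0n mulr0.
by apply: residueM; [exact: residueV|exact: residueX].
Qed.

(** The monic equation of x, divided by x^d, reads 1 plus multiples of 1 / x equals 0; residue 0 for
    1 / x would give 1 = 0 in F_2. *)
Lemma residue_inv_integral (K : fieldExtType rat) (y x : K) e :
    regular_side y e -> x != 0 -> integralOver (intr : int -> K) x ->
  ~ residue y e x^-1 0.
Proof.
move=> reg x0 [p /monicP p1 /rootP px0] xV0.
pose d := (size p).-1.
have : residue y e (\sum_(i < d.+1) (p`_i)%:~R * x^-1 ^+ (d - i))
    (\sum_(i < d.+1) (p`_i)%:~R * 0 ^+ (d - i)).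
  elim/big_ind2: _ => [|x1 v1 x2 v2|i _]; first exact: residue_nat 0%N.
    exact: residueD.
  by apply: residueM; [exact: residue_int|exact: residueX].
have -> : \sum_(i < d.+1) (p`_i)%:~R * x^-1 ^+ (d - i) = 0.
  transitivity ((map_poly intr p).[x] * x^-1 ^+ d); last by rewrite px0 mul0r.
  rewrite (@horner_coef_wide _ d.+1); last first.
    by rewrite (leq_trans (size_poly _ _)) ?leqSpred.
  rewrite mulr_suml; apply: eq_bigr => i _; rewrite coef_map_id0 //= -mulrA.
  congr (_ * _); have -> : x^-1 ^+ d = x^-1 ^+ i * x^-1 ^+ (d - i).
    by rewrite -exprD subnKC // -ltnS.
  rewrite mulrA -exprMn.
  by rewrite mulfV // expr1n mul1r.
rewrite big_ord_recr /= big1 => [|i _]; last by rewrite expr0n subn_eq0 leqNgt ltn_ord mulr0.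
rewrite add0r subnn mulr1 -[p`_d]/(lead_coef p) p1 => /(residue_uniq reg (residue_nat y e 0)).
by move/eqP; rewrite eq_sym oner_eq0.
Qed.

Lemma primitive_elt_int (K : fieldExtType rat) (y x : K) :
    <<1; y>>%VS = {:K}%VS ->
  exists2 n : nat, (0 < n)%N & exists p : {poly int}, x * n%:R = (map_poly intr p).[y].
Proof.
move=> gen; have : x \in <<1; y>>%VS by rewrite gen memvf.
case/Fadjoin_polyP => p0 /polyOver1P [p ->] ->.
have [q [a a0 ->]] := rat_poly_scale p.
have Eq : a%:~R * (map_poly (in_alg K) (a%:~R^-1 *: map_poly intr q)).[y] =
    (map_poly intr q).[y].
  rewrite map_polyZ hornerZ fmorphV rmorph_int mulVKf; last first.
    by rewrite -(rmorph_int (in_alg K)) fmorph_eq0 intr_eq0.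
  rewrite -map_poly_comp; congr (_ .[_]); apply: eq_map_poly => n.
  exact: (rmorph_int (in_alg K)).
(* A negative denominator passes its sign to the numerator [q]. *)
case: a a0 Eq => n a0 Eq; [exists n; first by rewrite lt0n|exists n.+1 => //].
  by exists q; rewrite mulrC -Eq -pmulrn.
by exists (- q); rewrite rmorphN hornerN -Eq NegzE mulrNz mulNr opprK mulrC -pmulrn.
Qed.

(** Write n x = p(y) and n = 2^l m with m odd. As y^e = 2 s, the product x y^(e l) equals p(y) s^l /
    m, which lies in the local ring because m is a unit there. The dichotomy applies, and
    integrality rules out its second case. *)
Lemma residue_integral (K : fieldExtType rat) (y x : K) e :
    regular_side y e -> <<1; y>>%VS = {:K}%VS ->
  integralOver (intr : int -> K) x -> exists v, residue y e x v.
Proof.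
move=> reg gen intx; have [->|x0] := eqVneq x 0; first by exists 0; exact: residue_nat 0%N.
have [n n0 [p Ep]] := primitive_elt_int x gen.
have [m odd_m En] := pfactor_coprime (isT : prime 2) n0.
set l := logn 2 n in En.
have mV : residue y e m%:R^-1 1.
  apply: residueV => //; suff <- : m%:R = 1 :> 'F_2 by exact: residue_nat.
  apply: F2_neq0; rewrite -(dvdn_pcharf (pchar_Fp (isT : prime 2))).
  by rewrite -prime_coprime.
have m0 : m%:R != 0 :> K.
  by rewrite ratext_natr_eq0; apply: contraTneq odd_m => ->.
have two0 : 2 != 0 :> K by rewrite ratext_natr_eq0.
have : residue y e (x * y ^+ (e * l)) ((map_poly intr p).[0] * 1 * 1 ^+ l).
  have -> : x * y ^+ (e * l) = (map_poly intr p).[y] * m%:R^-1 * (y ^+ e / 2) ^+ l.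
    rewrite -Ep En natrM natrX mulrA mulrAC exprM expr_div_n; field.
    by rewrite m0 expf_neq0.
  apply: residueM; last exact/residueX/residue_S.
  apply: residueM => //; apply: residue_horner.
  by have := residue_ev y e 'X; rewrite !ev2_X.
by case/(residue_dichotomy reg x0) => // /(residue_inv_integral reg x0 intx).
Qed.

(** * The three sides of the Newton polygon *)

(** At (y, y^e / 2) both [G] and [side e] vanish; cancelling 2^k leaves the side equation. *)
Lemma regular_sideP (K : fieldExtType rat) (y : K) (e k : nat) (G : {poly int})
    (A B D : {poly {poly int}}) :
    (0 < e)%N -> (map_poly intr G).[y] = 0 ->
    (forall p : {poly int}, (map_poly intr p).[y] = 0 -> exists Q, p = G * Q) ->
    G^:P = 2 ^+ k * ('X%:P ^+ 2 + 'X%:P + 2 * A + 'X * B) + side e * D ->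
  regular_side y e.
Proof.
move=> e0 Gy0 hG EG; split=> // [b|]; first exact: ev2_wd e0 hG EG.
exists A, B; have two0 : 2 != 0 :> K by rewrite ratext_natr_eq0.
have := congr1 (ev2 y (y ^+ e / 2)) EG; rewrite ev2_poly Gy0 rmorphD rmorphM /=.
have -> : ev2 y (y ^+ e / 2) (side e * D) = 0.
  rewrite /side rmorphM rmorphB rmorphM rmorphXn rmorph_nat /= ev2_X ev2_S.
  by rewrite mulrCA mulfV // mulr1 subrr mul0r.
rewrite addr0 rmorphXn rmorph_nat => /esym/eqP.
by rewrite mulf_eq0 expf_eq0 (negPf two0) andbF => /eqP.
Qed.

(* In these three identities (1 + Y)^q - 1 is called [t = y * t1], twice, and
   then [w]; [d] stands for [2 s - y ^ e]. *)
Lemma side4_identity (R : comNzRingType) (a t1 y s c d : R) :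
    let t := y * t1 in let z := s + 2 * a in
    t ^+ 4 = 2 * z - d ->
  (1 + t) ^+ 8 - 1 + 32 * c =
  2 ^+ 2 * (s ^+ 2 + s
     + 2 * (a * (2 * s + 2 * a + 1)
            + z * (2 * t ^+ 3 + 7 * t ^+ 2 + 14 * t + 17) + 4 * c)
     + y * (t1 * (14 * t ^+ 2 + 7 * t + 2)))
  + d * - (4 * z - d + 8 * t ^+ 3 + 28 * t ^+ 2 + 56 * t + 70).
Proof.
move=> t z Et.
(* Up to multiples of d, the terms t^8 and 70 t^4 give 4 (z^2 + 35 z), the source of s^2 + s. *)
have -> : (1 + t) ^+ 8 - 1 + 32 * c = t ^+ 4 * t ^+ 4
    + (8 * t ^+ 3 + 28 * t ^+ 2 + 56 * t + 70) * t ^+ 4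
    + 56 * t ^+ 3 + 28 * t ^+ 2 + 8 * t + 32 * c by ring.
by rewrite Et /z /t; ring.
Qed.

Lemma side2_identity (R : comNzRingType) (a t1 y s c d : R) :
    let t := y * t1 in let z := s + 2 * a in let w := 2 * z - d in
    t ^+ 2 = w ->
  (1 + t) ^+ 8 - 1 + 32 * c =
  2 ^+ 3 * (s ^+ 2 + s
     + 2 * (a * (2 * s + 2 * a + 1) + z ^+ 4 + (4 * t + 14) * z ^+ 3
            + (14 * t + 17) * z ^+ 2 + (7 * t + 3) * z + 2 * c)
     + y * t1)
  + d * - ((w + 2 * z) * (w ^+ 2 + 4 * z ^+ 2)
           + (8 * t + 28) * (w ^+ 2 + 2 * w * z + 4 * z ^+ 2)
           + (56 * t + 70) * (w + 2 * z) + (56 * t + 28)).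
Proof.
move=> t z w Et.
(* Here s^2 + s comes from 70 t^4 and 28 t^2, which give 8 (35 z^2 + 7 z). *)
have -> : (1 + t) ^+ 8 - 1 + 32 * c = (t ^+ 2) ^+ 4
    + (8 * t + 28) * (t ^+ 2) ^+ 3 + (56 * t + 70) * (t ^+ 2) ^+ 2
    + (56 * t + 28) * t ^+ 2 + 8 * t + 32 * c by ring.
by rewrite Et /w /z /t; ring.
Qed.

Lemma side1_identity (R : comNzRingType) (h y s c d : R) :
    let z := s + y * h in let w := 2 * z - d in
  (1 + w) ^+ 8 - 1 + 32 * c =
  2 ^+ 4 * (s ^+ 2 + s
     + 2 * (8 * z ^+ 8 + 32 * z ^+ 7 + 56 * z ^+ 6 + 56 * z ^+ 5 + 35 * z ^+ 4
            + 14 * z ^+ 3 + 3 * z ^+ 2 + c)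
     + y * (h * (2 * s + y * h + 1)))
  + d * - ((2 + w + 2 * z) * ((1 + w) ^+ 2 + (1 + 2 * z) ^+ 2)
           * ((1 + w) ^+ 4 + (1 + 2 * z) ^+ 4)).
Proof.
move=> z w.
have -> : s ^+ 2 + s
     + 2 * (8 * z ^+ 8 + 32 * z ^+ 7 + 56 * z ^+ 6 + 56 * z ^+ 5 + 35 * z ^+ 4
            + 14 * z ^+ 3 + 3 * z ^+ 2 + c)
     + y * (h * (2 * s + y * h + 1)) = z ^+ 2 + z
     + 2 * (8 * z ^+ 8 + 32 * z ^+ 7 + 56 * z ^+ 6 + 56 * z ^+ 5 + 35 * z ^+ 4
            + 14 * z ^+ 3 + 3 * z ^+ 2 + c) by rewrite /z; ring.
(* What remains is (1 + 2 z)^8 - 1 expanded, where 28 (2 z)^2 and 8 (2 z) give 16 (7 z^2 + z), and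
   the factorization of (1 + w)^8 - (1 + 2 z)^8. *)
have -> : d = 2 * z - w by rewrite /w; ring.
by ring.
Qed.

(** By repeated squaring: every term other than 1 and the top power acquires the factor 2 X. *)
Lemma expr1DX_2exp k : exists H : {poly int},
  (1 + 'X) ^+ (2 ^ k) = 1 + ('X^(2 ^ k) + 2 * 'X * H).
Proof.
elim: k => [|k [H EH]]; first by exists 0; rewrite mulr0 addr0.
rewrite expnSr !exprM EH; have E : 'X^(2 ^ k) = 'X * 'X ^+ (2 ^ k).-1 :> {poly int}.
  by rewrite -exprS prednK // expn_gt0.
rewrite E; set u := 'X ^+ (2 ^ k).-1.
exists (u + 2 * H + 2 * 'X * u * H + 2 * 'X * H ^+ 2).
by ring.
Qed.

Lemma regular_sides (K : fieldExtType rat) (y : K) (q : nat) (H C G : {poly int}) :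
    (0 < q)%N -> G = (1 + ('X^q + 2 * 'X * H)) ^+ 8 - 1 + 32 * C ->
    (map_poly intr G).[y] = 0 ->
    (forall p : {poly int}, (map_poly intr p).[y] = 0 -> exists Q, p = G * Q) ->
  [/\ regular_side y (q * 4), regular_side y (q * 2) & regular_side y q].
Proof.
move=> q0 EG Gy0 hG; pose h := H^:P; pose c := C^:P.
pose t1 : {poly {poly int}} := 'X ^+ q.-1 + 2 * h.
have Xq : 'X^q = 'X * 'X ^+ q.-1 :> {poly {poly int}} by rewrite -exprS prednK.
have Et : 'X * t1 = 'X^q + 2 * 'X * h by rewrite Xq /t1; ring.
have EGP : G^:P = (1 + 'X * t1) ^+ 8 - 1 + 32 * c.
  rewrite EG Et rmorphD rmorphB rmorphXn !rmorphD !rmorphM !rmorph_nat /=.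
  by rewrite rmorph1 rmorphXn /= map_polyX.
(* Chosen so that t^2 = Y^(2 q) + 4 x for t = Y^q + 2 Y h. Squaring gives t^4 = Y^(4 q) + 4 (2 Y^(2
   q) x + 4 x^2), hence the two values passed for [a]. *)
pose x : {poly {poly int}} := 'X^q * 'X * h + 'X^2 * h ^+ 2.
split.
- apply: (@regular_sideP K y _ 2 G) => //; first by rewrite muln_gt0 q0.
  rewrite EGP; apply: (@side4_identity _ (2 * 'X^q ^+ 2 * x + 4 * x ^+ 2)).
  by rewrite Et /side exprM /x; ring.
- apply: (@regular_sideP K y _ 3 G) => //; first by rewrite muln_gt0 q0.
  rewrite EGP; apply: (@side2_identity _ x).
  by rewrite Et /side exprM /x; ring.
- apply: (@regular_sideP K y _ 4 G) => //.
  rewrite EGP (_ : 'X * t1 = 2 * ('X%:P + 'X * h) - side q).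
    exact: side1_identity.
  by rewrite Et /side; ring.
Qed.

(** On each side the matching power of [tau] is y^e up to terms that, once halved, still have
    residue 0. These values will tell the three homomorphisms apart. *)
Lemma residue_tau (K : fieldExtType rat) (y : K) (q : nat) (H : {poly int}) :
    (0 < q)%N -> let tau := y ^+ q + 2 * y * (map_poly intr H).[y] in
  [/\ residue y (q * 4) (tau ^+ 4 / 2) 1, residue y (q * 2) (tau ^+ 2 / 2) 1,
      residue y (q * 2) tau 0 & residue y q (tau / 2) 1].
Proof.
move=> q0 tau; set h' := (map_poly intr H).[y].
have two0 : 2 != 0 :> K by rewrite ratext_natr_eq0.
have F2 : 2%:R = 0 :> 'F_2 by exact: pcharf0 (pchar_Fp _).
have resX e : residue y e y 0 by have := residue_ev y e 'X; rewrite !ev2_X.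
have resXq e : residue y e (y ^+ q) 0.
  by rewrite -[0](_ : 0 ^+ q = 0); [exact: residueX | rewrite expr0n eqn0Ngt q0].
have resh e : residue y e h' (map_poly intr H).[0] by exact: residue_horner.
have res2 e x v : residue y e x v -> residue y e (2 * x) 0.
  by move=> xv; rewrite -(mul0r v) -F2; apply: residueM => //; exact: residue_nat.
have restau e : residue y e tau 0.
  rewrite -[0]addr0; apply: residueD => //; rewrite -mulrA.
  by apply: (res2 _ _ _ _); apply: residueM.
pose x := y ^+ q * y * h' + y ^+ 2 * h' ^+ 2.
have resx e : exists v, residue y e x v.
  eexists; apply: residueD; apply: residueM => //; try exact: residueX.
  exact: residueM.
split=> //.
- have [v xv] := resx (q * 4)%N.
  have -> : tau ^+ 4 / 2 = y ^+ (q * 4) / 2 + 2 * (2 * (y ^+ q ^+ 2 * x) + 4 * x ^+ 2).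
    by rewrite /tau /x exprM -/h'; field.
  rewrite -[X in residue _ _ _ X]addr0; apply: residueD; first exact: residue_S.
  apply: (res2 _ _ _ _); apply: residueD.
    by apply: (res2 _ _ _ _); apply: residueM; [exact: residueX|exact: xv].
  by apply: residueM; [exact: residue_nat|by apply: residueX; exact: xv].
- have [v xv] := resx (q * 2)%N.
  have -> : tau ^+ 2 / 2 = y ^+ (q * 2) / 2 + 2 * x.
    by rewrite /tau /x exprM -/h'; field.
  by rewrite -[X in residue _ _ _ X]addr0; apply: residueD (residue_S _ _) (res2 _ _ _ xv).
- have -> : tau / 2 = y ^+ q / 2 + y * h' by rewrite /tau -/h'; field.
  rewrite -[X in residue _ _ _ X]addr0; apply: residueD; first exact: residue_S.
  by rewrite -(mul0r (map_poly intr H).[0]); exact: residueM.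
Qed.

(** * Integrality criteria *)

Lemma integralX (R K : comNzRingType) (f : {rmorphism R -> K}) (u : K) n :
  integralOver f u -> integralOver f (u ^+ n).
Proof.
move=> fu; elim: n => [|n IHn]; first exact: integral1.
by rewrite exprS; exact: integral_mul.
Qed.

Lemma integral_quartic (R K : comNzRingType) (f : {rmorphism R -> K}) (x a b c d : K) :
    integralOver f a -> integralOver f b -> integralOver f c -> integralOver f d ->
    x ^+ 4 + a * x ^+ 3 + b * x ^+ 2 + c * x + d = 0 ->
  integralOver f x.
Proof.
move=> fa fb fc fd E.
pose p : {poly K} := Poly [:: d; c; b; a; 1].
have pE : p = [:: d; c; b; a; 1] :> seq K by rewrite (PolyK (c := 0)) //= oner_neq0.
apply: (@integral_root_monic _ _ f x p).
- by rewrite monicE lead_coefE pE.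
- by rewrite rootE horner_Poly /= -[X in _ == X]E; apply/eqP; ring.
- move=> z; rewrite pE !inE => /or4P [/eqP->|/eqP->|/eqP->|] //.
  by case/orP => /eqP -> //; exact: integral1.
Qed.

(* The last coefficient of Horner's scheme for the (not monic) equation of s. *)
Lemma integral_horner_quartic (R K : comNzRingType) (f : {rmorphism R -> K})
    (s c4 c3 c2 c1 c0 : K) :
    integralOver f c4 -> integralOver f c3 -> integralOver f c2 ->
    integralOver f c1 -> integralOver f c0 ->
    c4 * s ^+ 4 + c3 * s ^+ 3 + c2 * s ^+ 2 + c1 * s + c0 = 0 ->
  integralOver f (c4 * s ^+ 3 + c3 * s ^+ 2 + c2 * s + c1).
Proof.
move=> f4 f3 f2 f1 f0 E; set z := (X in integralOver _ X).
have zs : z * s = - c0 by apply/eqP; rewrite -addr_eq0 -E; apply/eqP; rewrite /z; ring.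
(* Multiply the definition of z by z^3 and replace each z s by - c0. *)
apply: (@integral_quartic _ _ f z (- c1) (c2 * c0) (- (c3 * c0 ^+ 2)) (c4 * c0 ^+ 3)).
- exact: integral_opp.
- exact: integral_mul.
- by apply: integral_opp; apply: integral_mul => //; exact: integralX.
- by apply: integral_mul => //; exact: integralX.
have -> : c0 = - (z * s) by rewrite zs opprK.
have -> : z ^+ 4 = z ^+ 3 * (c4 * s ^+ 3 + c3 * s ^+ 2 + c2 * s + c1) by rewrite exprSr.
by ring.
Qed.

(** * Agreement of two homomorphisms on Z[eta], and the index *)

Lemma F2_pigeonhole (u v w : 'F_2) : [\/ u = v, u = w | v = w].
Proof.
have [->|/F2_neq0 ->] := eqVneq u 0; have [->|/F2_neq0 ->] := eqVneq v 0;
  have [->|/F2_neq0 ->] := eqVneq w 0; by constructor.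
Qed.

(** An odd N is 1 in F_2, so the residue of x is p(v), determined by the residue of eta. *)
Lemma residue_agree (K : fieldExtType rat) (y eta x : K) (e e' N : nat) v w w' p :
    regular_side y e -> regular_side y e' -> odd N ->
    x * N%:R = (map_poly intr p).[eta] ->
    residue y e eta v -> residue y e' eta v ->
  residue y e x w -> residue y e' x w' -> w = w'.
Proof.
move=> reg reg' oddN E ev ev' xw xw'.
have N1 : N%:R = 1 :> 'F_2.
  by apply: F2_neq0; rewrite -(dvdn_pcharf (pchar_Fp (isT : prime 2))) dvdn2 oddN.
have val f u : regular_side y f -> residue y f eta v -> residue y f x u ->
    u = (map_poly intr p).[v].
  move=> regf etav xu; apply: (residue_uniq regf (x := x * N%:R)).
    by rewrite -[u]mulr1 -N1; apply: residueM => //; exact: residue_nat.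
  by rewrite E; exact: residue_horner.
by rewrite (val e w reg ev xw) (val e' w' reg' ev' xw').
Qed.

Ltac integrality :=
  repeat first [assumption | apply: integral_nat | apply: integralX |
                apply: integral_add | apply: integral_mul].

(** Two of the three residues of eta coincide, which forces the same two residues of every integral
    element to coincide; [x] and [z] below contradict this. The multiplier N will be the index, or 1
    if Z_K = Z[eta]. *)
Lemma no_odd_multiple (K : fieldExtType rat) (y eta : K) (q N : nat)
    (H C G : {poly int}) :
    (0 < q)%N -> G = (1 + ('X^q + 2 * 'X * H)) ^+ 8 - 1 + 32 * C ->
    (map_poly intr G).[y] = 0 ->
    (forall p : {poly int}, (map_poly intr p).[y] = 0 -> exists Q, p = G * Q) ->
    <<1; y>>%VS = {:K}%VS ->
    integralOver (intr : int -> K) y -> integralOver (intr : int -> K) eta ->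
    odd N ->
  ~ forall x, integralOver (intr : int -> K) x ->
      exists p, x * N%:R = (map_poly intr p).[eta].
Proof.
move=> q0 EG Gy0 hG gen inty inteta oddN mulN.
have [reg4 reg2 reg1] := regular_sides q0 EG Gy0 hG.
have [] := residue_tau y H q0.
set tau := (X in X ^+ 4); move=> res4 res2 restau res1.
set c := (map_poly intr C).[y].
have two0 : 2 != 0 :> K by rewrite ratext_natr_eq0.
have F2 : 2%:R = 0 :> 'F_2 by exact: pcharf0 (pchar_Fp _).
pose f : {rmorphism {poly int} -> K} := horner_eval y \o map_poly intr.
have fX : f 'X = y by rewrite /= map_polyX /horner_eval hornerX.
have Etau : (1 + tau) ^+ 8 - 1 + 32 * c = 0.
  move: Gy0; rewrite -[_.[y]]/(f G) EG rmorphD rmorphB rmorphXn !rmorphD !rmorphM.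
  by rewrite !rmorph_nat rmorph1 rmorphXn fX.
have int_horner (p : {poly int}) : integralOver (intr : int -> K) (map_poly intr p).[y].
  apply: integral_horner => //; apply/integral_poly => i.
  by rewrite coef_map_id0 //; exact: (integral_id intr).
have intc : integralOver (intr : int -> K) c by exact: int_horner.
have inttau : integralOver (intr : int -> K) tau.
  have -> : tau = (map_poly intr ('X^q + 2 * 'X * H)).[y].
    by rewrite -[RHS]/(f _) rmorphD !rmorphM rmorphXn rmorph_nat fX.
  exact: int_horner.
pose x := tau ^+ 4 / 2; pose s := tau ^+ 2 / 2.
have intx : integralOver (intr : int -> K) x.
  (* The equation of [tau] divided by 4 is a monic quadratic in x; a factor x^2 makes it a
     quartic. *)
  apply: (@integral_quartic _ _ intr x
    (4 * tau ^+ 3 + 14 * tau ^+ 2 + 28 * tau + 35)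
    (14 * tau ^+ 3 + 7 * tau ^+ 2 + 2 * tau + 8 * c) 0 0); try exact: integral0.
  - by integrality.
  - by integrality.
  transitivity (x ^+ 2 * ((1 + tau) ^+ 8 - 1 + 32 * c) / 4); last by rewrite Etau mulr0 mul0r.
  by rewrite /x; field; rewrite ?ratext_natr_eq0.
(* Divided by 8, the equation of [tau] is a quartic in s with leading coefficient 2. Its Horner
   coefficient z is integral, and equals s + 1 up to a double. *)
pose z := 2 * s ^+ 3 + (8 * tau + 28) * s ^+ 2 + (28 * tau + 35) * s + (14 * tau + 7).
have intz : integralOver (intr : int -> K) z.
  apply: (@integral_horner_quartic _ _ intr s _ _ _ _ (tau + 4 * c)); try by integrality.
  transitivity (((1 + tau) ^+ 8 - 1 + 32 * c) / 8); last by rewrite Etau mul0r.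
  by rewrite /s; field; rewrite ?ratext_natr_eq0.
have resnat e n : residue y e n%:R n%:R by exact: residue_nat.
have res0 e u v : residue y e u v -> residue y e (2 * u) 0.
  by move=> uv; rewrite -(mul0r v) -F2; apply: residueM.
have x2 : residue y (q * 2) x 0.
  have -> : x = 2 * s ^+ 2 by rewrite /x /s; field.
  by apply: res0; apply: residueX; exact: res2.
have x1 : residue y q x 0.
  have -> : x = 2 * (4 * (tau / 2) ^+ 4) by rewrite /x; field.
  by apply: (res0 _ _ _ _); apply: residueM => //; apply: residueX; exact: res1.
have s1 : residue y q s 0.
  have -> : s = 2 * (tau / 2) ^+ 2 by rewrite /s; field.
  by apply: (res0 _ _ _ _); apply: residueX; exact: res1.
have tau1 : residue y q tau 0.
  by have := res0 _ _ _ res1; rewrite mulrC divfK.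
have resz e u : residue y e tau 0 -> residue y e s u -> residue y e z (u + 1).
  move=> et es; rewrite -[u]add0r.
  have -> : z = 2 * (s ^+ 3 + (4 * tau + 14) * s ^+ 2 + (14 * tau + 17) * s + (7 * tau + 3))
                + s + 1 by rewrite /z; ring.
  apply: residueD (resnat _ 1%N); apply: residueD => //.
  eapply res0; repeat first [exact: resnat | exact: et | exact: es | apply: residueX |
                             apply: residueD | apply: residueM].
have [v4 etav4] := residue_integral reg4 gen inteta.
have [v2 etav2] := residue_integral reg2 gen inteta.
have [v1 etav1] := residue_integral reg1 gen inteta.
have [[px Ex] [pz Ez]] := (mulN x intx, mulN z intz).
have ne01 : 1 <> 0 :> 'F_2 by apply/eqP; rewrite oner_eq0.
(* On the sides 4 q, 2 q, q the residues of x are 1, 0, 0; those of z on 2 q and q are 0 and 1. *)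
have [E|E|E] := F2_pigeonhole v4 v2 v1.
- by rewrite E in etav4; apply: ne01; apply: (residue_agree reg4 reg2 oddN Ex etav4 etav2).
- by rewrite E in etav4; apply: ne01; apply: (residue_agree reg4 reg1 oddN Ex etav4 etav1).
rewrite E in etav2; apply: ne01; apply/esym.
apply: (residue_agree reg2 reg1 oddN Ez etav2 etav1).
  by rewrite -[0](F2 : 1 + 1 = 0 :> 'F_2); exact: (resz _ _ restau res2).
by rewrite -[1]add0r; exact: (resz _ _ tau1 s1).
Qed.

(* Translation by [x] permutes the cosets: compare the sums of representatives. *)
Lemma subgroup_index_mul (V : zmodType) (A B : set V) (x : V) :
    (forall u v, A u -> A v -> A (u + v)) ->
    B 0 -> (forall u v, B u -> B v -> B (u - v)) ->
    (0 < subgroup_index A B)%N -> A x ->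
  B (x *+ subgroup_index A B).
Proof.
move=> AD B0 BB ind0 Ax.
have BN u : B u -> B (- u) by move=> Bu; rewrite -sub0r; exact: BB.
have BD u v : B u -> B v -> B (u + v).
  by move=> Bu Bv; rewrite -(opprK v); apply: BB => //; exact: BN.
(* An infinite set of cosets would give the default index 0. *)
have fin : finite_set (cosets A B).
  apply: contrapT => inf; move: ind0.
  by rewrite /subgroup_index /fset_set; case: pselect => // _; rewrite cardfs0.
pose h (c : set V) := [set x + v | v in c]%classic.
pose rep (c : set V) : V := xget 0 c.
set C := fset_set (cosets A B).
have CE c : (c \in (C : seq (set V))) = (c \in cosets A B) by rewrite in_fset_set.
have repP c : c \in (C : seq (set V)) -> c (rep c) /\ forall v, c v -> B (v - rep c).
  rewrite CE inE => -[a _ <-].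
  have cr : [set a + b | b in B]%classic (rep [set a + b | b in B]%classic).
    by apply: xgetPex; exists a, 0 => //; rewrite addr0.
  split=> // v [b Bb <-]; move: cr => [b' Bb' <-].
  by rewrite opprD addrACA subrr add0r; exact: BB.
have hC c : c \in (C : seq (set V)) -> h c \in (C : seq (set V)).
  rewrite !CE !inE => -[a Aa <-]; exists (x + a); first exact: AD.
  apply/seteqP; split=> v /=.
    by move=> [b Bb <-]; exists (a + b); [exists b|rewrite addrA].
  by move=> [_ [b Bb <-] <-]; exists b; rewrite // addrA.
have h_inj : injective h.
  move=> c c' E; apply/seteqP; split=> v cv.
    have : h c (x + v) by exists v.
    by rewrite E => -[w cw /addrI <-].
  have : h c' (x + v) by exists v.
  by rewrite -E => -[w cw /addrI <-].
have hperm : perm_eq (map h C) C.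
  have u : uniq (map h C) by rewrite map_inj_uniq // fset_uniq.
  apply: uniq_perm => //; first exact: fset_uniq.
  have sub : {subset map h C <= C} by move=> c /mapP [d dC ->]; exact: hC.
  by have [] := uniq_min_size u sub; rewrite ?size_map.
(* x + [rep c] and [rep (h c)] lie in the same coset. In the sum the representatives cancel, leaving
   one x per coset. *)
have Bsum : B (\sum_(c <- C) (x + rep c - rep (h c))).
  rewrite big_seq; elim/big_ind: _ => // c cC.
  have [_ ] := repP _ (hC _ cC); apply.
  by exists (rep c) => //; have [] := repP _ cC.
move: Bsum; rewrite sumrB big_split /= -(big_map h predT rep) (perm_big _ hperm) /=.
by rewrite addrK big_const_seq count_predT iter_addr_0.
Qed.

(** * Divisibility by the irreducible polynomial, and the theorem *)

(** For R nonzero, either a Bezout relation evaluated at x gives 0 = 1, or P divides R, against the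
    sizes. *)
Lemma irreducible_root_small (K : fieldExtType rat) (P R : {poly rat}) (x : K) :
    irreducible_poly P -> root (map_poly (in_alg K) P) x ->
    root (map_poly (in_alg K) R) x -> (size R < size P)%N ->
  R = 0.
Proof.
move=> [_ irrP] /rootP Px /rootP Rx ltRP; apply/eqP; apply: contraTT ltRP => R0.
rewrite -leqNgt; have [|g1] := boolP (coprimep P R).
  case/Bezout_eq1_coprimepP => -[u v] /= /(congr1 (map_poly (in_alg K))).
  rewrite rmorphD !rmorphM rmorph1 => /(congr1 (horner^~ x)).
  by rewrite hornerD !hornerM Px Rx !mulr0 addr0 hornerC => /esym/eqP; rewrite oner_eq0.
have /eqp_size <- : gcdp P R %= P by apply: irrP; [exact: g1|exact: dvdp_gcdl].
by rewrite dvdp_leq // dvdp_gcdr.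
Qed.

Lemma map_poly_intr_alg (K : fieldExtType rat) (p : {poly int}) :
  map_poly intr p = map_poly (in_alg K) (map_poly intr p).
Proof.
rewrite -map_poly_comp; apply: eq_map_poly => n /=.
exact/esym/(rmorph_int (in_alg K)).
Qed.

(** As F is monic, division with remainder works over Z; the remainder vanishes at x, hence is 0
    over Q and so over Z. *)
Lemma monic_irreducible_dvd (K : fieldExtType rat) (F p : {poly int}) (x : K) :
    F \is monic -> irreducible_poly (map_poly intr F : {poly rat}) ->
    root (map_poly intr F) x -> (map_poly intr p).[x] = 0 ->
  exists Q, p = F * Q.
Proof.
move=> Fmon irrF Fx px; exists (Pdiv.Ring.rdivp p F).
have Ep := Pdiv.RingMonic.rdivp_eq Fmon p; set R := Pdiv.Ring.rmodp p F in Ep.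
suff R0 : R = 0 by rewrite [LHS]Ep R0 addr0 mulrC.
have szq (q : {poly int}) : size (map_poly intr q : {poly rat}) = size q.
  by apply: size_map_inj_poly => //; exact: intr_inj.
have : map_poly intr R = 0 :> {poly rat}.
  apply: (irreducible_root_small irrF (x := x)); rewrite -?map_poly_intr_alg //.
    apply/rootP; have -> : R = p - Pdiv.Ring.rdivp p F * F.
      by rewrite {1}Ep addrAC subrr add0r.
    by rewrite rmorphB rmorphM /= hornerD hornerN hornerM px (rootP Fx) mulr0 subrr.
  by rewrite !szq Pdiv.Ring.ltn_rmodp monic_neq0.
by move/eqP; rewrite -size_poly_eq0 szq size_poly_eq0 => /eqP.
Qed.

Unset Implicit Arguments.

Theorem theorem1p5 (r m : nat) (a b : int) (F : {poly int})
  (K : fieldExtType rat) (theta : K)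
  (hr : (3 <= r)%N) (hm1 : (1 <= m)%N) (hm2 : (m < 2 ^ r)%N)
  (hF : F = 'X^(2 ^ r) + a%:P * 'X^m + b%:P)
  (hirr : irreducible_poly (map_poly intr F : {poly rat}))
  (hroot : root (map_poly intr F) theta)
  (hK : <<1; theta>>%VS = {:K}%VS)
  (ha : (32 %| a)%Z) (hb : (32 %| b + 1)%Z) :
  prime_common_index_divisor K 2 /\ ~ monogenic K.
Proof.
pose q := (2 ^ (r - 3))%N; have q0 : (0 < q)%N by rewrite expn_gt0.
have Er : (2 ^ r = q * 8)%N by rewrite /q -(expnD 2 _ 3) subnK.
pose y := theta - 1.
have Fmon : F \is monic.
  rewrite hF -addrA monicE lead_coefDl ?lead_coefXn // size_polyXn ltnS.
  rewrite (leq_trans (size_polyD _ _)) // geq_max.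
  rewrite (leq_trans (size_polyC_leq1 _)) ?expn_gt0 // andbT.
  rewrite mul_polyC (leq_trans (size_scale_leq _ _)) // size_polyXn.
  exact: hm2.
have inttheta : integralOver (intr : int -> K) theta by exists F.
have inty : integralOver (intr : int -> K) y by apply: integral_sub => //; exact: integral1.
have geny : <<1; y>>%VS = {:K}%VS.
  apply/eqP; rewrite eqEsubv subvf -hK; apply/FadjoinP; split; first exact: subv_adjoin.
  by rewrite -(subrK 1 theta) rpredD ?memv_adjoin // rpred1.
have [H EH] := expr1DX_2exp (r - 3).
have /divzK Ea := ha; have /divzK Eb := hb.
pose G := F \Po ('X + 1).
(* Collects the quotients by 32 of a and of b + 1; the remaining -1 of b is the -1 in [EG]. *)
pose C : {poly int} := (a %/ 32)%Z%:P * ('X + 1) ^+ m + ((b + 1) %/ 32)%Z%:P.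
have P32 : (32%:Z)%:P = 32 :> {poly int} by rewrite -[32%:Z in LHS]natz polyC_natr.
have EG : G = (1 + ('X^q + 2 * 'X * H)) ^+ 8 - 1 + 32 * C.
  rewrite -EH -/q [1 + 'X]addrC /G hF Er exprM !comp_polyD !rmorphXn /=.
  rewrite comp_polyM !rmorphXn /= !comp_polyC comp_polyX.
  have -> : b%:P = 32 * ((b + 1) %/ 32)%Z%:P - 1 :> {poly int}.
    by rewrite -[b in LHS](addrK 1) -{1}Eb polyCB polyCM P32 mulrC.
  have -> : a%:P = 32 * (a %/ 32)%Z%:P :> {poly int} by rewrite -{1}Ea polyCM P32 mulrC.
  by rewrite /C; ring.
have evK (p : {poly int}) (c : int) (x : K) :
    (map_poly intr (p \Po ('X + c%:P))).[x] = (map_poly intr p).[x + c%:~R].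
  by rewrite map_comp_poly horner_comp rmorphD /= map_polyX map_polyC !hornerE.
have Gy0 : (map_poly intr G).[y] = 0.
  by rewrite /G evK subrK; exact/rootP.
have hG (p : {poly int}) : (map_poly intr p).[y] = 0 -> exists Q, p = G * Q.
  (* Translation carries the root y of p to the root theta of [F], and the quotient is translated
     back. *)
  move=> py0; have [|Q EQ] :=
    @monic_irreducible_dvd K F (p \Po ('X + (-1)%:P)) theta Fmon hirr hroot.
    by rewrite evK.
  exists (Q \Po ('X + 1)); rewrite -rmorphM /= -EQ -comp_polyA.
  by rewrite comp_polyD comp_polyX comp_polyC polyCN addrK comp_polyXr.
have noodd eta N := @no_odd_multiple K y eta q N H C G q0 EG Gy0 hG geny inty.
split; last first.
  move=> [eta inteta EK]; apply: (noodd eta 1%N inteta isT) => x intx.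
  have : Zadjoin eta x by rewrite -EK.
  by case=> p _ <-; exists p; rewrite mulr1.
split=> //; have [_] := gcd_setP [set ind eta | eta in
    [set eta : K | ring_of_integers K eta /\ <<1; eta>>%VS = {:K}%VS]]%classic.
(* By maximality of the gcd, each index must be shown even. An odd one is positive, so
   multiplication by it maps Z_K into Z[eta]. *)
apply=> _ [eta [inteta _] <-]; rewrite dvdn2; apply/negP => oddN.
apply: (noodd eta _ inteta oddN) => x intx.
have : Zadjoin eta (x *+ ind eta).
  apply: subgroup_index_mul => //.
  - by move=> u v; exact: integral_add.
  - by exists 0 => //; rewrite rmorph0 horner0.
  - move=> _ _ [p _ <-] [p' _ <-]; exists (p - p') => //.
    by rewrite rmorphB hornerD hornerN.
  - exact: odd_gt0.
by case=> p _ E; exists p; rewrite mulr_natr -E.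
Qed.
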